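(* Let $K$ be a field, $S=K[x_1,\ldots,x_n]$, let $I\subset S$ be a nonzero squarefree monomial ideal, and let $\alpha=(a_1,\ldots,a_n)\in\mathbb{N}^n$ with $a_i\neq 0$ for all $i$. If Stanley's conjecture holds for $I$, i.e. $\operatorname{sdepth}(I)\ge\operatorname{depth}(I)$, then Stanley's conjecture also holds for $I^{\alpha}$, i.e. $\operatorname{sdepth}(I^{\alpha})\ge\operatorname{depth}(I^{\alpha})$.
   Context: Depth is taken with respect to the graded maximal ideal $\mathfrak m=(x_1,\ldots,x_n)$ of $S$, with ideals regarded as $S$-modules. Trivial modification: for $\alpha=(a_1,\ldots,a_n)\in\mathbb{N}^n$ with $a_i\ne0$ for all $i$, let $\sigma_\alpha:S\to S$ be the (flat) $K$-algebra morphism given by $x_i\mapsto x_i^{a_i}$ for $i=1,\ldots,n$. Then $I^{\alpha}:=\sigma_\alpha(I)S$ is called a trivial modification of the squarefree monomial ideal $I$. Stanley depth: let $M$ be a nonzero finitely generated multigraded ($\mathbb{Z}^n$-graded) $S$-module. For a homogeneous $z\in M$ and $Z\subseteq\{x_1,\ldots,x_n\}$, let $zK[Z]$ be the $K$-subspace of $M$ of all elements $zf$, $f\in K[Z]$; it is called a Stanley space of dimension $|Z|$ if it is a free $K[Z]$-module. A Stanley decomposition of $M$ is a presentation of $M$ as a finite direct sum (of $K$-vector spaces) of Stanley spaces $\mathcal{D}: M=\bigoplus_{i=1}^r z_iK[Z_i]$. Put $\operatorname{sdepth}\mathcal{D}=\min\{|Z_i| : i=1,\ldots,r\}$, and let $\operatorname{sdepth}(M)$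 be the maximum of $\operatorname{sdepth}\mathcal{D}$ over all Stanley decompositions $\mathcal{D}$ of $M$. Stanley's conjecture for $M$ is the inequality $\operatorname{sdepth}(M)\ge\operatorname{depth}(M)$. *)

(* Defs.v *)
From HB Require Import structures.
From mathcomp Require Import all_boot all_order all_algebra.
From mathcomp Require Import boolp classical_sets.
From mathcomp.multinomials Require Export mpoly.

Set Implicit Arguments.
Unset Strict Implicit.
Unset Printing Implicit Defensive.

Import GRing.Theory.
Local Open Scope classical_set_scope.
Local Open Scope ring_scope.

Section Ideals.
Variables (n : nat) (K : fieldType).
Local Notation S := {mpoly K[n]}.
Implicit Types (G I J : set S) (s : seq S) (z f u : S) (Z : {set 'I_n}).

(* The improper ideal S is allowed (unlike ssreflect's [idealr_closed]). *)
Definition is_ideal I : Prop :=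
  [/\ I 0, forall f g, I f -> I g -> I (f + g) & forall f g, I g -> I (f * g)].

Definition ideal_gen G : set S := smallest is_ideal G.

Definition ideal_mul I J : set S := ideal_gen [set f * g | f in I & g in J].

Definition max_ideal : set S := ideal_gen (range (fun i : 'I_n => 'X_i)).

Definition squarefree_mnm (m : 'X_{1..n}) : Prop := forall i, (m i <= 1)%N.

(* [E] needs no finiteness condition: there are 2 ^ n squarefree monomials. *)
Definition squarefree_monomial_ideal I : Prop :=
  exists E : set 'X_{1..n},
    E `<=` squarefree_mnm /\ I = ideal_gen [set 'X_[m] | m in E].

Definition sigma (a : 'I_n -> nat) (f : S) : S :=
  comp_mpoly [tuple 'X_i ^+ a i | i < n] f.

Definition trivial_modification (a : 'I_n -> nat) I : set S :=
  ideal_gen (sigma a @` I).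

(* [s] = f_1, ..., f_k is regular on the S-module I: f_(i+1) is a nonzerodivisor
   on I / (f_1, ..., f_i) I for all i < k, and I / (f_1, ..., f_k) I <> 0. *)
Definition regular_seq I s : Prop :=
  (forall i u, (i < size s)%N -> I u ->
     ideal_mul (ideal_gen [set` take i s]) I (s`_i * u) ->
     ideal_mul (ideal_gen [set` take i s]) I u)
  /\ ideal_mul (ideal_gen [set` s]) I <> I.

(* For a nonzero ideal I, the set of lengths below contains 0 and is bounded
   (by n = dim S), so that this supremum is a maximum. *)
Definition depth I : nat :=
  supremum 0%N
    [set k | exists s, [/\ size s = k, [set` s] `<=` max_ideal & regular_seq I s]].

Definition homogeneous z : Prop :=
  exists (c : K) (m : 'X_{1..n}), z = c *: 'X_[m].

Definition polys_in Z : set S :=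
  [set f | forall m, m \in msupp f -> forall i, i \notin Z -> m i = 0%N].

Definition span_in z Z : set S := [set z * f | f in polys_in Z].

(* Freeness of z K[Z] over K[Z] is freeness on the generator z. *)
Definition stanley_space I z Z : Prop :=
  [/\ I z, homogeneous z & forall f, polys_in Z f -> z * f = 0 -> f = 0].

Definition stanley_decomposition I r (z : 'I_r -> S) (Z : 'I_r -> {set 'I_n})
    : Prop :=
  [/\ forall i, stanley_space I (z i) (Z i),
      forall u, I u <-> exists2 v : 'I_r -> S,
        forall i, span_in (z i) (Z i) (v i) & u = \sum_(i < r) v i
    & forall v : 'I_r -> S, (forall i, span_in (z i) (Z i) (v i)) ->
        \sum_(i < r) v i = 0 -> forall i, v i = 0].

(* The neutral element n does not affect the minimum when 0 < r, since every
   #|Z i| is at most n; and 0 < r in every decomposition of a nonzero I. *)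
Definition sdepth_decomposition r (Z : 'I_r -> {set 'I_n}) : nat :=
  \big[minn/n]_(i < r) #|Z i|.

(* For a nonzero monomial ideal I, the set below is nonempty and bounded by n,
   so that this supremum is a maximum. *)
Definition sdepth I : nat :=
  supremum 0%N
    [set d | exists r (z : 'I_r -> S) (Z : 'I_r -> {set 'I_n}),
       stanley_decomposition I z Z /\ sdepth_decomposition Z = d].

End Ideals.

(* Main.v *)
Require Import Defs.
From mathcomp Require Import all_boot all_order all_algebra.
From mathcomp Require Import boolp classical_sets.
From mathcomp Require Import ring.

(** Write J for the trivial modification of I. The two invariants are compared
    separately: depth J = depth I and sdepth I <= sdepth J, so that Stanley's
    inequality passes from I to J.

    Both comparisons rest on the fact that S is free over its subring sigma(S),
    with basis the monomials x^b such that b_i < a_i for all i (the reduced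
    ones): a monomial x^w is x^b sigma(x^q), where q and b are the quotient and
    the remainder of w by a. The coordinate of u along x^b is [retract b u],
    and u lies in the modification of an ideal B if and only if all its
    coordinates lie in B ([trivial_modificationP]).

    Depth. If f_1, ..., f_k is regular on I, then its image under sigma is
    regular on J, by looking at coordinates ([regular_sigma]). Conversely let J
    have a regular sequence of length k, and let g be a regular sequence on I of
    length j < k; it is enough to lengthen g. The image of g is regular on J
    and shorter than k, so by Rees' theorem ([regular_shorter_no_socle]) the
    quotient of J by it has no nonzero element killed by the maximal ideal m.
    The same then holds for I/(g)I: the image of a socle element would be
    killed by all the x_i^(a_i), hence some monomial multiple of it would be a
    nonzero socle element ([no_socle_power]). Finally, a module without socle
    has a nonzerodivisor in m ([no_socle_nonzerodivisor]), because its zero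
    divisors form a finite union of associated primes and prime avoidance gives
    an element of m outside of them. Hence I and J have regular sequences of
    exactly the same lengths.

    All modules that occur are subquotients A/B of S, so they are handled as
    pairs of ideals. The needed part of Rees' theorem is proved by exchange:
    two regular sequences admit a common nonzerodivisor h, which is put in
    front of both of them after their last terms have been dropped.

    Stanley depth. A Stanley decomposition of I is a partition of the monomials
    of I into cones x^k K[Z]. The monomials of J are those whose quotient by a
    is in I, and the set of monomials with quotient in a given cone is the
    disjoint union of the cones x^(ak+b) K[Z], where b runs over the reduced
    exponents that vanish on Z ([cone_quo]). The same sets Z occur. *)

Set Implicit Arguments.
Unset Strict Implicit.
Unset Printing Implicit Defensive.

Import Order.TTheory GRing.Theory.
Local Open Scope classical_set_scope.
Local Open Scope ring_scope.

(** * The polynomial ring is Noetherian *)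

(** Each new index is a minimiser of u on the tail beyond the previous one; the
    values then increase because the tails shrink. *)
Lemma nondecreasing_subsequence (u : nat -> nat) :
  exists2 phi : nat -> nat, {homo phi : i j / (i < j)%N}
    & {homo u \o phi : i j / (i <= j)%N}.
Proof.
have tail_min N : exists i, (N <= i)%N /\ forall j, (N <= j)%N -> (u i <= u j)%N.
  have ex_val : exists v, `[< exists2 i, (N <= i)%N & u i = v >].
    by exists (u N); apply/asboolP; exists N.
  case: (ex_minnP ex_val) => v /asboolP[i leNi <-] min_v.
  exists i; split=> // j leNj; apply: min_v; apply/asboolP; by exists j.
have [g gP] := choice tail_min.
pose phi := fix phi i := if i is i'.+1 then g (phi i').+1 else g 0%N.
exists phi.
- by apply: homo_ltn => [j i k|i]; [exact: ltn_trans|case: (gP (phi i).+1)].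
- apply: homo_leq => [//|j i k|i]; first exact: leq_trans.
  have lt_phi : (phi i < phi i.+1)%N by case: (gP (phi i).+1).
  case: i lt_phi => [|i] lt_phi /=.
    by case: (gP 0%N) => _; apply; apply: leq_trans (ltnW lt_phi).
  case: (gP (phi i).+1) => lt_phi_i; apply.
  exact: leq_trans lt_phi_i (ltnW lt_phi).
Qed.

(** Dickson's lemma: coordinate by coordinate, pass to a subsequence on which
    that coordinate is nondecreasing. *)
Lemma dickson n (m : nat -> 'X_{1..n}) :
  exists i j, (i < j)%N /\ (m i <= m j)%MM.
Proof.
suff [phi mono_phi le_m] : exists2 phi : nat -> nat,
    {homo phi : i j / (i < j)%N} & forall c, c \in enum 'I_n ->
      {homo (fun i => m (phi i) c) : i j / (i <= j)%N}.
  exists (phi 0%N), (phi 1%N); split; first exact: mono_phi.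
  by apply/mnm_lepP => c; apply: le_m; rewrite // mem_enum.
elim: (enum 'I_n) => [|c s [phi mono_phi le_m]]; first by exists id.
have [psi mono_psi le_c] := nondecreasing_subsequence (fun i => m (phi i) c).
exists (phi \o psi) => [i j lt_ij|d]; first exact/mono_phi/mono_psi.
rewrite inE => /predU1P[-> //|/le_m le_d] i j le_ij /=; apply: le_d.
exact: (@ltnW_homo psi).
Qed.

Section Ideals.
Variables (n : nat) (K : fieldType).
Local Notation S := {mpoly K[n]}.
Implicit Types (A B C P : set S) (f g h u v w : S) (s us : seq S).
Implicit Type (Ps : seq (set S)).

Lemma ideal0 A : is_ideal A -> A 0. Proof. by case. Qed.
Lemma idealD A f g : is_ideal A -> A f -> A g -> A (f + g).
Proof. by case=> _ + _; apply. Qed.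
Lemma idealM A f g : is_ideal A -> A g -> A (f * g).
Proof. by case=> _ _; apply. Qed.
Lemma idealB A f g : is_ideal A -> A f -> A g -> A (f - g).
Proof. by move=> iA Af Ag; rewrite -mulN1r; apply: idealD => //; apply: idealM. Qed.
Lemma ideal_sum A (J : Type) (r : seq J) (p : pred J) (F : J -> S) :
  is_ideal A -> (forall j, p j -> A (F j)) -> A (\sum_(j <- r | p j) F j).
Proof.
move=> iA AF; elim/big_ind: _ => //; first exact: ideal0.
by move=> f g; apply: idealD.
Qed.

Lemma is_ideal0 : is_ideal [set (0 : S)].
Proof.
split=> [//|f g -> ->|f g ->]; first by rewrite addr0.
by rewrite mulr0.
Qed.

Lemma ideal_gen_ideal (G : set S) : is_ideal (ideal_gen G).
Proof.
split=> [A [iA _]|f g Gf Gg A AG|f g Gg A AG]; first exact: ideal0.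
- by case: (AG) => iA _; apply: idealD => //; [apply: Gf|apply: Gg].
- by case: (AG) => iA _; apply: idealM => //; apply: Gg.
Qed.

Lemma ideal_gen_sub (G A : set S) : is_ideal A -> G `<=` A -> ideal_gen G `<=` A.
Proof. exact: smallest_sub. Qed.

(** In a strictly increasing chain A_0, A_1, ... choose f_i in A_(i+1) outside
    A_i with the smallest possible leading monomial. By Dickson's lemma some
    leading monomial divides a later one, and subtracting a multiple of the
    earlier polynomial from the later one contradicts minimality. *)
Lemma noetherian (F : set (set S)) :
  F !=set0 -> (forall A, F A -> is_ideal A) ->
  exists2 A, F A & forall B, F B -> A `<=` B -> B `<=` A.
Proof.
move=> [A0 FA0] idF; apply: contrapT => no_max.
have step (A : {A | F A}) : exists Bf : {B | F B} * S,
    [/\ sval A `<=` sval Bf.1, sval Bf.1 Bf.2, ~ sval A Bf.2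
      & forall g, sval Bf.1 g -> ~ sval A g -> (mlead Bf.2 <= mlead g)%O].
  case: A => A FA /=.
  have [B FB [leAB [g0 [Bg0 nAg0]]]] : exists2 B, F B &
      A `<=` B /\ exists g, B g /\ ~ A g.
    apply: contrapT => noB; apply: no_max; exists A => // B FB leAB g Bg.
    by apply: contrapT => nAg; apply: noB; exists B => //; split=> //; exists g.
  suff [f [Bf nAf min_f]] : exists f, [/\ B f, ~ A f &
      forall g, B g -> ~ A g -> (mlead f <= mlead g)%O].
    by exists (exist _ B FB, f).
  move: {2}(mlead g0) (erefl (mlead g0)) => mu; move: g0 Bg0 nAg0.
  elim/(well_founded_ind (@ltom_wf n)): mu => mu IH f Bf nAf def_mu.
  have [[g [Bg nAg lt_gf]]|no_g] :=
    pselect (exists g, [/\ B g, ~ A g & (mlead g < mlead f)%O]).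
    by apply: (IH (mlead g)) Bg nAg erefl; rewrite -def_mu.
  exists f; split=> // g Bg nAg; rewrite leNgt; apply/negP => lt_gf.
  by apply: no_g; exists g.
have [next nextP] := choice step.
pose c := fix c i := if i is i'.+1 then (next (c i')).1 else exist _ A0 FA0.
pose f i := (next (c i)).2.
have c_mono : forall i j, (i <= j)%N -> sval (c i) `<=` sval (c j).
  move=> i j; elim: j => [|j IHj]; first by rewrite leqn0 => /eqP ->.
  rewrite leq_eqVlt => /predU1P[-> //|/IHj le_ij].
  by apply: subset_trans le_ij _; case: (nextP (c j)).
have id_c i : is_ideal (sval (c i)) by apply: idF; case: (c i).
have f_neq0 i : f i != 0.
  apply/eqP => f0; case: (nextP (c i)) => _ _ + _; rewrite -/(f i) f0.
  by apply; apply: ideal0.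
have [i [j [lt_ij le_m]]] := dickson (fun i => mlead (f i)).
have [le_c cf nf min_f] := nextP (c j).
have cfi : sval (c j) (f i).
  by apply: (c_mono i.+1) => //; case: (nextP (c i)).
(* Cancelling the leading term of f j against f i contradicts minimality. *)
pose d := (mlead (f j) - mlead (f i))%MM.
pose t := ((f j)@_(mlead (f j)) / (f i)@_(mlead (f i))) *: 'X_[d] : S.
pose g := f j - t * f i.
have ctf : sval (c j) (t * f i) by apply: idealM.
have ng : ~ sval (c j) g.
  move=> cg; apply: nf; rewrite -/(f j).
  by rewrite -(subrK (t * f i) (f j)); apply: idealD.
have cg : sval (c j.+1) g by apply: idealB => //; apply: le_c.
have g_neq0 : g != 0 by apply/eqP => g0; apply: ng; rewrite g0; apply: ideal0.
have mdf : (d + mlead (f i))%MM = mlead (f j) by rewrite submK.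
have lc_neq0 k : (f k)@_(mlead (f k)) != 0 by rewrite mleadc_eq0.
have lead_t : mlead (t * f i) = mlead (f j).
  have t0 : t != 0.
    rewrite scaler_eq0 negb_or mulf_neq0 ?invr_neq0 //=.
    by rewrite -msupp_eq0 msuppX.
  by rewrite mleadM // mleadZ ?mulf_neq0 ?invr_neq0 // mleadXm.
have := min_f _ cg ng; rewrite -/(f j) leNgt => /negP; apply.
rewrite lt_neqAle; apply/andP; split; last first.
  by apply: le_trans (mleadB_le _ _) _; rewrite lead_t joinxx.
apply/eqP => lead_g; move: g_neq0; rewrite -mleadc_eq0 lead_g.
rewrite mcoeffB /t -scalerAl mcoeffZ.
have -> : ('X_[d] * f i)@_(mlead (f j)) = (f i)@_(mlead (f i)).
  by rewrite mulrC -mdf mcoeffMX.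
by rewrite divfK // subrr eqxx.
Qed.

End Ideals.

(** * Prime ideals and prime avoidance *)

Section PrimeIdeals.
Variables (n : nat) (K : fieldType).
Local Notation S := {mpoly K[n]}.
Implicit Types (P Q M : set S) (Ps : seq (set S)).

Definition prime_ideal P : Prop :=
  [/\ is_ideal P, ~ P 1 & forall f g, P (f * g) -> P f \/ P g].

(** Take the product of elements of the members of Ps that are outside P. *)
Lemma prime_ideal_meet P Ps :
  prime_ideal P -> (forall Q, Q \in Ps -> is_ideal Q /\ ~ Q `<=` P) ->
  exists2 t, ~ P t & forall Q, Q \in Ps -> Q t.
Proof.
move=> [idP P1 primeP]; elim: Ps => [|Q Ps IH] PsP; first by exists 1.
have [t Pt Pst] : exists2 t, ~ P t & forall Q, Q \in Ps -> Q t.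
  by apply: IH => R PsR; apply: PsP; rewrite inE PsR orbT.
have [idQ /existsNP[q /not_implyP[Qq Pq]]] := PsP Q (mem_head _ _).
exists (t * q) => [/primeP[]//|R].
rewrite inE => /predU1P[->|PsR]; first exact: idealM.
have [idR _] := PsP R (@mem_behead _ (Q :: Ps) R PsR).
by rewrite mulrC; apply: idealM => //; apply: Pst.
Qed.

(** Suppose that h in M avoids Ps but lies in a further prime P. If no member of
    Ps is below P, then some t outside P lies in M and in all of Ps, and h + t
    leaves P without entering the others. *)
Lemma prime_avoidance M Ps :
  is_ideal M -> (forall P, P \in Ps -> prime_ideal P /\ ~ M `<=` P) ->
  exists2 h, M h & forall P, P \in Ps -> ~ P h.
Proof.
move=> idM; move: {2}(size Ps) (erefl (size Ps)) => k.
elim: k Ps => [|k IH] [|P Ps] // => [_ _|[size_Ps] PsP].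
  by exists 0; first exact: ideal0.
have [primeP MP] := PsP P (mem_head _ _).
have PsP' Q : Q \in Ps -> prime_ideal Q /\ ~ M `<=` Q.
  by move=> PsQ; apply: PsP; rewrite inE PsQ orbT.
have [[Q0 PsQ0 leQ0]|no_sub] := pselect (exists2 Q, Q \in Ps & Q `<=` P).
  (* An element outside P is outside the ideals below P, so P may replace them
     in Ps; it then occurs there already and need not be added. *)
  pose up Q := if `[< Q `<=` P >] then P else Q.
  have [||h Mh hPs] := IH (map up Ps); first by rewrite size_map.
    move=> _ /mapP[Q PsQ ->]; rewrite /up; case: ifP => _ //; exact: PsP'.
  exists h => // Q; rewrite inE => /predU1P[->|PsQ].
    by apply: hPs; apply/mapP; exists Q0; rewrite // /up asboolT.
  have := hPs (up Q) (map_f _ PsQ); rewrite /up.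
  by case: asboolP => // leQP + Qh; apply; apply: leQP.
have [h Mh hPs] := IH Ps size_Ps PsP'.
have [Ph|] := pselect (P h); last first.
  by exists h => // Q; rewrite inE => /predU1P[->|/hPs].
have [|t Pt Mt] := @prime_ideal_meet P (M :: Ps) primeP.
  move=> Q; rewrite inE => /predU1P[->|PsQ]; first by [].
  split; first by case: (PsP' Q PsQ) => -[].
  by move=> leQP; apply: no_sub; exists Q.
exists (h + t) => [|Q].
  by apply: idealD => //; apply: Mt; rewrite mem_head.
rewrite inE => /predU1P[->|PsQ] Qht.
  by apply: Pt; rewrite -(addKr h t) addrC; apply: idealB => //; case: primeP.
apply: (hPs Q PsQ); rewrite -(addrK t h); apply: idealB => //.
  by case: (PsP' Q PsQ) => -[].
by apply: Mt; rewrite inE PsQ orbT.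
Qed.

End PrimeIdeals.

(** * Subquotients A/B of the polynomial ring, regular sequences, Rees' theorem *)

Section Subquotients.
Variables (n : nat) (K : fieldType).
Local Notation S := {mpoly K[n]}.
Implicit Types (A B C M P : set S) (f g h u v w : S) (s us : seq S).
Implicit Type (Ps : seq (set S)).

(** The ideal B + f A: the module A/(B + f A) is the quotient of A/B by f. *)
Definition add_mul A B f : set S := [set b + f * a | b in B & a in A].

Definition add_muls A B s : set S := foldl (add_mul A) B s.

Definition nonzerodivisor A B f : Prop :=
  forall u, A u -> B (f * u) -> B u.

(** When M is a maximal ideal, this is the vanishing of the socle of A/B. *)
Definition no_socle M A B : Prop :=
  forall u, A u -> (forall f, M f -> B (f * u)) -> B u.

Fixpoint regular A B s : Prop :=
  if s is f :: s' then nonzerodivisor A B f /\ regular A (add_mul A B f) s'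
  else True.

(** The element h is tested on A/B and on its successive quotients by proper
    initial segments of s, but not on the quotient by all of s. *)
Fixpoint nonzerodivisor_along A B s h : Prop :=
  if s is f :: s' then
    nonzerodivisor A B h /\ nonzerodivisor_along A (add_mul A B f) s' h
  else True.

Lemma add_mul_ideal A B f : is_ideal A -> is_ideal B -> is_ideal (add_mul A B f).
Proof.
move=> idA idB; split.
- by exists 0; [exact: ideal0|exists 0; [exact: ideal0|rewrite mulr0 addr0]].
- move=> _ _ [b Bb [a Aa <-]] [b' Bb' [a' Aa' <-]].
  exists (b + b'); first exact: idealD.
  by exists (a + a'); [exact: idealD|rewrite mulrDr addrACA].
- move=> g _ [b Bb [a Aa <-]].
  exists (g * b); first exact: idealM.
  by exists (g * a); [exact: idealM|rewrite mulrDr mulrCA].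
Qed.

Lemma sub_add_mul A B f : is_ideal A -> B `<=` add_mul A B f.
Proof.
by move=> idA b Bb; exists b => //; exists 0; rewrite ?mulr0 ?addr0 //; apply: ideal0.
Qed.

Lemma add_mulAC A B f g :
  add_mul A (add_mul A B f) g = add_mul A (add_mul A B g) f.
Proof.
suff le f' g' : add_mul A (add_mul A B f') g' `<=` add_mul A (add_mul A B g') f'.
  by apply/seteqP; split; apply: le.
move=> _ [_ [b Bb [c Ac <-]] [d Ad <-]].
by exists (b + g' * d); [exists b => //; exists d|exists c; rewrite // addrAC].
Qed.

Lemma add_muls_ideal A B s :
  is_ideal A -> is_ideal B -> is_ideal (add_muls A B s).
Proof.
move=> idA; elim: s B => [//|f s IH] B idB /=.
by apply: IH; apply: add_mul_ideal.
Qed.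

Lemma add_muls_rcons A B s f :
  add_muls A B (rcons s f) = add_mul A (add_muls A B s) f.
Proof. by rewrite /add_muls -cats1 foldl_cat. Qed.

Lemma add_mulsAC A B s h :
  add_muls A (add_mul A B h) s = add_mul A (add_muls A B s) h.
Proof. by elim: s B => [//|f s IH] B /=; rewrite add_mulAC IH. Qed.

Lemma add_muls_sub A B C s :
  (forall f a, f \in s -> A a -> C (f * a)) -> is_ideal C ->
  B `<=` C -> add_muls A B s `<=` C.
Proof.
move=> + idC; elim: s B => [//|f s IH] B sC BC /=; apply: IH.
  by move=> g a gs Aa; apply: sC => //; rewrite inE gs orbT.
move=> _ [b Bb [a Aa <-]]; apply: idealD => //; first exact: BC.
by apply: sC; rewrite ?mem_head.
Qed.

Lemma sub_add_muls A B s : is_ideal A -> B `<=` add_muls A B s.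
Proof.
move=> idA; elim: s B => [B|f s IH B] /=; first exact: subset_refl.
by apply: subset_trans (IH _); apply: sub_add_mul.
Qed.

Lemma add_muls_mem A B s f a :
  is_ideal A -> is_ideal B -> f \in s -> A a -> add_muls A B s (f * a).
Proof.
move=> idA; elim: s B => [//|g s IH] B idB.
rewrite inE => /predU1P[->|fs] Aa /=; last by apply: IH => //; exact: add_mul_ideal.
apply: (@sub_add_muls _ _ s idA).
by exists 0; [exact: ideal0|exists a; rewrite ?add0r].
Qed.

Lemma regular_rcons A B s f :
  regular A B (rcons s f) <->
  regular A B s /\ nonzerodivisor A (add_muls A B s) f.
Proof.
elim: s B => [|g s IH] B /=; first by split=> -[].
by rewrite IH; split=> [[? []]|[[]]].
Qed.

Lemma nonzerodivisor_along_rcons A B s f h :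
  nonzerodivisor_along A B (rcons s f) h ->
  nonzerodivisor A (add_muls A B s) h.
Proof. by elim: s B => [|g s IH] B /= [] // _; apply: IH. Qed.

Lemma regular_no_socle M A B f :
  M f -> nonzerodivisor A B f -> no_socle M A B.
Proof. by move=> Mf nzf u Au Mu; apply: nzf => //; apply: Mu. Qed.

Definition annihilator B u : set S := [set f | B (f * u)].

Lemma annihilator_ideal B u : is_ideal B -> is_ideal (annihilator B u).
Proof.
move=> idB; split=> [|f g Bf Bg|f g Bg].
- by rewrite /annihilator /= mul0r; apply: ideal0.
- by rewrite /annihilator /= mulrDl; apply: idealD.
- by rewrite /annihilator /= -mulrA; apply: idealM.
Qed.

(** The maximal annihilators of nonzero elements of A/B are prime, and every
    zero divisor lies in one of them. There are finitely many: the elements with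
    maximal annihilator generate, modulo B, an ideal that finitely many of them,
    us, already generate. The intersection of the annihilators of us is below
    any other maximal annihilator, which by primality contains one of them and
    thus equals it. *)
Lemma associated_primes A B :
  is_ideal A -> is_ideal B ->
  exists us, [/\ forall u, u \in us -> A u /\ ~ B u,
    forall u, u \in us -> prime_ideal (annihilator B u) &
    forall h, (forall u, u \in us -> ~ annihilator B u h) ->
      nonzerodivisor A B h].
Proof.
move=> idA idB.
pose X u := [/\ A u, ~ B u & forall v, A v -> ~ B v ->
  annihilator B u `<=` annihilator B v -> annihilator B v `<=` annihilator B u].
have X_above v : A v -> ~ B v -> exists2 u, X u & annihilator B v `<=` annihilator B u.
  move=> Av nBv.
  pose F := [set Q | exists u, [/\ A u, ~ B u, annihilator B v `<=` annihilator B u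
    & Q = annihilator B u]].
  have [|_ [u [_ _ _ ->]]|_ [u [Au nBu le_vu ->]] maxu] := @noetherian n K F.
  - by exists (annihilator B v), v; split.
  - exact: annihilator_ideal.
  exists u => //; split=> // w Aw nBw le_uw; apply: maxu => //.
  by exists w; split=> //; apply: subset_trans le_uw.
have X_prime u : X u -> prime_ideal (annihilator B u).
  move=> [Au nBu maxu]; split; first exact: annihilator_ideal.
    by rewrite /annihilator /= mul1r.
  move=> f g Bfgu; have [|nBgu] := pselect (annihilator B u g); first by right.
  left; apply: (maxu (g * u)) => //; first exact: idealM.
    by move=> k Bku; rewrite /annihilator /= mulrCA; apply: idealM.
  by rewrite /annihilator /= mulrA.
pose F := [set Q | exists us, (forall u, u \in us -> X u) /\ Q = add_muls setT B us].
have idT : is_ideal [set: S] by [].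
have [|_ [us [_ ->]]|_ [us [usX ->]] max_us] := @noetherian n K F.
- by exists B, [::].
- exact: add_muls_ideal.
have X_us v : X v -> add_muls setT B us v.
  move=> Xv; apply: (max_us (add_muls setT B (rcons us v))).
  - by exists (rcons us v); split=> // u; rewrite mem_rcons inE => /predU1P[->|/usX].
  - by rewrite add_muls_rcons; apply: sub_add_mul.
  - have := @add_muls_mem setT B (rcons us v) v 1 idT idB.
    by rewrite mulr1; apply=> //; rewrite mem_rcons mem_head.
(* X lies in B + (us), so what kills us modulo B kills X. *)
have us_below v : X v -> exists2 u, u \in us & annihilator B u `<=` annihilator B v.
  move=> Xv; apply: contrapT => no_u.
  have [|t Bvt us_t] := @prime_ideal_meet _ _ (annihilator B v)
      (map (annihilator B) us) (X_prime v Xv).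
    move=> _ /mapP[u us_u ->]; split; first exact: annihilator_ideal.
    by move=> le_uv; apply: no_u; exists u.
  apply: Bvt.
  have idC : is_ideal [set w | B (t * w)].
    split=> [|f g|f g]; rewrite /= ?mulr0 ?mulrDr; first exact: ideal0.
      exact: idealD.
    by rewrite mulrCA; apply: idealM.
  apply: (@add_muls_sub setT B [set w | B (t * w)] us) (X_us v Xv) => //.
    move=> u a us_u _; rewrite /= mulrA mulrC; apply: idealM => //.
    exact: us_t (map_f _ us_u).
  by move=> b Bb; apply: idealM.
exists us; split=> [u /usX[]//|u /usX/X_prime//|h h_us u Au Bhu].
apply: contrapT => nBu.
have [v Xv le_uv] := X_above u Au nBu.
have [w us_w le_wv] := us_below v Xv.
have [_ _ maxw] := usX w us_w.
apply: (h_us w us_w); apply: (maxw v) => //; try by case: Xv.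
exact: le_uv.
Qed.

(** To miss the zero divisors of A/B it suffices to avoid finitely many primes
    that do not contain M. Stating this in terms of primes lets several modules
    be treated at once. *)
Lemma no_socle_primes M A B :
  is_ideal A -> is_ideal B -> no_socle M A B ->
  exists2 Ps : seq (set S), forall P, P \in Ps -> prime_ideal P /\ ~ M `<=` P &
    forall h, (forall P, P \in Ps -> ~ P h) -> nonzerodivisor A B h.
Proof.
move=> idA idB socB; have [us [usAB us_prime us_zd]] := associated_primes idA idB.
exists (map (annihilator B) us) => [_ /mapP[u us_u ->]|h h_us].
  split=> [|Mu]; first exact: us_prime.
  by have [Au] := usAB u us_u; apply; apply: socB.
by apply: us_zd => u us_u; apply: h_us; apply: map_f.
Qed.

Lemma no_socle_nonzerodivisor M A B :
  is_ideal M -> is_ideal A -> is_ideal B -> no_socle M A B ->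
  exists2 h, M h & nonzerodivisor A B h.
Proof.
move=> idM idA idB /(no_socle_primes idA idB)[Ps PsP Ps_nzd].
by have [h Mh hPs] := prime_avoidance idM PsP; exists h => //; apply: Ps_nzd.
Qed.

Lemma regular_primes M A B s :
  is_ideal A -> is_ideal B -> [set` s] `<=` M -> regular A B s ->
  exists2 Ps : seq (set S), forall P, P \in Ps -> prime_ideal P /\ ~ M `<=` P &
    forall h, (forall P, P \in Ps -> ~ P h) -> nonzerodivisor_along A B s h.
Proof.
move=> idA; elim: s B => [|f s IH] B idB sM /=; first by exists [::].
move=> [nzf reg_s].
have s'M : [set` s] `<=` M by move=> g gs; apply: sM; rewrite /= inE gs orbT.
have [Ps PsP Ps_nzd] := IH _ (add_mul_ideal f idA idB) s'M reg_s.
have Mf : M f by apply: sM; rewrite /= mem_head.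
have [Qs QsP Qs_nzd] := no_socle_primes idA idB (regular_no_socle Mf nzf).
exists (Qs ++ Ps) => [P|h hPs]; first by rewrite mem_cat => /orP[/QsP|/PsP].
by split; [apply: Qs_nzd|apply: Ps_nzd] => P PP; apply: hPs;
  rewrite mem_cat PP ?orbT.
Qed.

Lemma common_nonzerodivisor M A B s t :
  is_ideal M -> is_ideal A -> is_ideal B ->
  [set` s] `<=` M -> [set` t] `<=` M -> regular A B s -> regular A B t ->
  exists h, [/\ M h, nonzerodivisor_along A B s h & nonzerodivisor_along A B t h].
Proof.
move=> idM idA idB sM tM /(regular_primes idA idB sM)[Ps PsP Ps_nzd].
move=> /(regular_primes idA idB tM)[Qs QsP Qs_nzd].
have [|h Mh hPs] := @prime_avoidance _ _ M (Ps ++ Qs) idM.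
  by move=> P; rewrite mem_cat => /orP[/PsP|/QsP].
exists h; split=> //; [apply: Ps_nzd|apply: Qs_nzd] => P PP; apply: hPs;
  by rewrite mem_cat PP ?orbT.
Qed.

(** For one element g of s: if g u = h v modulo B, then v is in B + g A since h
    is a nonzerodivisor modulo g; writing v = g w modulo B and cancelling g
    gives u = h w modulo B. *)
Lemma regular_add_mul A B s f h :
  is_ideal A -> is_ideal B ->
  regular A B s -> nonzerodivisor_along A B (rcons s f) h ->
  regular A (add_mul A B h) s.
Proof.
move=> idA; elim: s B => [//|g s IH] B idB /= [nzg reg_s] [nzh nzh_s].
have idBg : is_ideal (add_mul A B g) by exact: add_mul_ideal.
split; last by rewrite add_mulAC; apply: IH.
move=> u Au [b Bb [v Av def_gu]].
have nzhg : nonzerodivisor A (add_mul A B g) h by case: s nzh_s {IH reg_s} => [|? ?] [].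
have [b' Bb' [w Aw def_v]] : add_mul A B g v.
  apply: nzhg => //; exists (-1 * b); first exact: idealM.
  by exists u => //; rewrite -def_gu mulN1r addKr.
exists (u - h * w); last by exists w; rewrite // subrK.
apply: nzg; first by apply: idealB => //; apply: idealM.
have -> : g * (u - h * w) = b + h * b'.
  by rewrite mulrBr -def_gu -def_v; ring.
by apply: idealD => //; apply: idealM.
Qed.

(** For nonzerodivisors g and h the socles of A/(C + g A) and A/(C + h A) are
    isomorphic: u in the first one goes to the v such that h u = g v modulo
    C. *)
Lemma no_socle_exchange M A C g h :
  is_ideal A -> is_ideal C -> M g -> M h ->
  nonzerodivisor A C g -> nonzerodivisor A C h ->
  no_socle M A (add_mul A C h) -> no_socle M A (add_mul A C g).
Proof.
move=> idA idC Mg Mh nzg nzh soc_h u Au Mu.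
have [c Cc [v Av def_hu]] := Mu h Mh.
have [c' Cc' [w Aw def_v]] : add_mul A C h v.
  apply: soc_h => // f Mf; have [d Cd [w Aw def_fu]] := Mu f Mf.
  exists (f * v - h * w); last by exists w; rewrite // subrK.
  apply: nzg; first by apply: idealB => //; apply: idealM.
  have -> : g * (f * v - h * w) = h * d - f * c.
    have -> : g * (f * v - h * w) = f * (g * v) - h * (g * w) by ring.
    have -> : g * v = h * u - c by rewrite -def_hu addrC addKr.
    have -> : g * w = f * u - d by rewrite -def_fu addrC addKr.
    by ring.
  by apply: idealB => //; apply: idealM.
exists (u - g * w); last by exists w; rewrite // subrK.
apply: nzh; first by apply: idealB => //; apply: idealM.
have -> : h * (u - g * w) = c + g * c' by rewrite mulrBr -def_hu -def_v; ring.
by apply: idealD => //; apply: idealM.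
Qed.

(** Rees' theorem, in the form that a regular sequence t shorter than another one
    leaves a quotient without socle and so can be lengthened. Drop the last terms of s and t and divide A/B by a common nonzerodivisor h;
    induction shows that A/B modulo h and all but the last term of t has no
    socle, and there h may be exchanged with the last term of t. *)
Lemma regular_shorter_no_socle M A B s t :
  is_ideal M -> is_ideal A -> is_ideal B ->
  [set` s] `<=` M -> [set` t] `<=` M -> regular A B s -> regular A B t ->
  (size t < size s)%N -> no_socle M A (add_muls A B t).
Proof.
move=> idM idA; move: {2}(size t) (erefl (size t)) => k.
elim: k B s t => [|k IH] B s t size_t idB sM tM reg_s reg_t.
  case: t size_t tM reg_t => // _ _ _.
  case: s sM reg_s => // f s sM [nzf _] _.
  by apply: regular_no_socle nzf; apply: sM; rewrite /= mem_head.
case/lastP: t size_t tM reg_t => // t g; rewrite size_rcons => -[size_t] tM reg_t.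
case/lastP: s sM reg_s => // s f sM reg_s; rewrite size_rcons ltnS => lt_ts.
have [h [Mh nz_s nz_t]] := common_nonzerodivisor idM idA idB sM tM reg_s reg_t.
have [reg_s' _] := (regular_rcons _ _ _ _).1 reg_s.
have [reg_t' nzg] := (regular_rcons _ _ _ _).1 reg_t.
have := IH (add_mul A B h) s t size_t (add_mul_ideal _ idA idB).
rewrite add_mulsAC add_muls_rcons => soc_h.
apply: no_socle_exchange Mh nzg _ _ => //.
- exact: add_muls_ideal.
- by apply: tM; rewrite /= mem_rcons mem_head.
- exact: nonzerodivisor_along_rcons nz_t.
apply: soc_h lt_ts.
- by move=> u us; apply: sM; rewrite /= mem_rcons inE us orbT.
- by move=> u us; apply: tM; rewrite /= mem_rcons inE us orbT.
- exact: regular_add_mul nz_s.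
- exact: regular_add_mul nz_t.
Qed.

End Subquotients.

(** * Depth of an ideal through regular sequences on A/B *)

Section RegularSequences.
Variables (n : nat) (K : fieldType).
Local Notation S := {mpoly K[n]}.
Local Notation m := (@max_ideal n K).
Implicit Types (A B I J : set S) (f g h u v w : S) (s : seq S).

(** This identifies the modules I/(s)I in the definition of depth with the
    subquotients on which regular sequences are studied here. *)
Lemma ideal_mul_add_muls I s :
  is_ideal I -> ideal_mul (ideal_gen [set` s]) I = add_muls I [set 0] s.
Proof.
move=> idI; have id0 := is_ideal0 n K; apply/seteqP; split.
  apply: ideal_gen_sub; first exact: add_muls_ideal.
  move=> _ [f sf [g Ig <-]].
  have idC : is_ideal [set f | forall g, I g -> add_muls I [set 0] s (f * g)].
    have idD := add_muls_ideal s idI id0.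
    split=> [g' _|f' g' If Ig' h Ih|f' g' Ig' h Ih]; rewrite ?mul0r.
    - exact: ideal0.
    - by rewrite mulrDl; apply: idealD; [|apply: If|apply: Ig'].
    - by rewrite -mulrA; apply: idealM => //; apply: Ig'.
  apply: (ideal_gen_sub idC _ sf) => // h /= hs g' Ig'.
  exact: add_muls_mem.
apply: add_muls_sub; last by move=> _ ->; apply: ideal0; apply: ideal_gen_ideal.
  move=> f a fs Ia; apply: sub_gen_smallest; exists f; last by exists a.
  exact: sub_gen_smallest.
exact: ideal_gen_ideal.
Qed.

Lemma regular_take A B s :
  regular A B s <-> forall i, (i < size s)%N ->
    nonzerodivisor A (add_muls A B (take i s)) s`_i.
Proof.
elim: s B => [|f s IH] B //=; split=> [[nzf /IH reg_s] [|i] //|reg_s].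
  by rewrite ltnS => /reg_s.
by split; [apply: (reg_s 0%N)|apply/IH => i; apply: (reg_s i.+1)].
Qed.

Definition order_ge d : set S := [set f | forall k, k \in msupp f -> (d <= mdeg k)%N].

Lemma order_geD d f g : order_ge d f -> order_ge d g -> order_ge d (f + g).
Proof.
by move=> Hf Hg k /msuppD_le; rewrite mem_cat => /orP[/Hf|/Hg].
Qed.

Lemma order_geM d e f g : order_ge d f -> order_ge e g -> order_ge (d + e) (f * g).
Proof.
move=> Hf Hg k /msuppM_le /allpairsP[[k1 k2] /= [/Hf le1 /Hg le2 ->]].
by rewrite mdegD leq_add.
Qed.

Lemma order_ge_ideal d : is_ideal (order_ge d).
Proof.
split=> [k|f g|f g Hg]; [by rewrite msupp0|exact: order_geD|].
by rewrite -[d]add0n; apply: order_geM.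
Qed.

Lemma max_ideal_order f : m f -> order_ge 1 f.
Proof.
apply: ideal_gen_sub f; first exact: order_ge_ideal.
by move=> _ [i _ <-] k; rewrite msuppX inE => /eqP ->; rewrite mdeg1.
Qed.

Lemma max_ideal_ideal : is_ideal m. Proof. exact: ideal_gen_ideal. Qed.

Lemma max_ideal_mem i : m 'X_i.
Proof. by apply: sub_gen_smallest; exists i. Qed.

(** The elements of m have no constant term, so I = m I would force all elements
    of I to vanish at the origin to every order. *)
Lemma nakayama I s :
  is_ideal I -> I <> [set 0] -> [set` s] `<=` m -> add_muls I [set 0] s <> I.
Proof.
move=> idI I0 sm sI.
have [f If f0] : exists2 f, I f & f <> 0.
  apply: contrapT => noI; apply: I0; apply/seteqP; split=> [f If|_ ->].
    by apply: contrapT => f0; apply: noI; exists f.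
  exact: ideal0.
have I_order d : I `<=` order_ge d.
  elim: d => [|d IHd]; first by move=> ?.
  rewrite -{1}sI; apply: add_muls_sub; last by move=> _ ->; apply: ideal0; apply: order_ge_ideal.
    move=> g a gs Ia; apply: (@order_geM 1); last exact: IHd.
    by apply: max_ideal_order; apply: sm.
  exact: order_ge_ideal.
have := I_order (msize f) f If (mlead f); rewrite mlead_supp ?(introN eqP) //.
by move=> /(_ isT); rewrite -mlead_deg ?ltnn //; apply/eqP.
Qed.

Definition depth_lengths I : set nat :=
  [set k | exists s, [/\ size s = k, [set` s] `<=` m & regular I [set 0] s]].

(** The nondegeneracy condition on regular sequences is automatic for sequences
    in m on a nonzero ideal, by Nakayama's lemma. *)
Lemma depthE I : is_ideal I -> I <> [set 0] ->
  depth I = supremum 0%N (depth_lengths I).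
Proof.
move=> idI I0; congr supremum; apply/seteqP; split=> k [s [size_s sm reg_s]];
  exists s; split=> //.
- apply/regular_take => i lt_i u Iu; rewrite -ideal_mul_add_muls //.
  by case: reg_s => + _; apply.
- split; last by rewrite ideal_mul_add_muls //; apply: nakayama.
  move=> i u lt_i Iu; rewrite ideal_mul_add_muls //.
  exact: (regular_take _ _ _).1 reg_s i lt_i u Iu.
Qed.

End RegularSequences.

(** * Depth of a trivial modification *)

Section TrivialModification.
Variables (n : nat) (K : fieldType) (a : 'I_n -> nat).
Hypothesis a_neq0 : forall i, a i <> 0%N.
Local Notation S := {mpoly K[n]}.
Local Notation m := (@max_ideal n K).
Local Notation T := (@trivial_modification n K a).
Local Notation sigma := (@sigma n K a).
Implicit Types (A B I : set S) (f g h u v w : S) (s : seq S).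
Implicit Types (b k l : 'X_{1..n}).

Let a_gt0 i : (0 < a i)%N. Proof. by rewrite lt0n; apply/eqP. Qed.

Definition mnm_scale k : 'X_{1..n} := [multinom (a i * k i)%N | i < n].
Definition mnm_quo k : 'X_{1..n} := [multinom (k i %/ a i)%N | i < n].
Definition mnm_rem k : 'X_{1..n} := [multinom (k i %% a i)%N | i < n].
Definition reduced b := [forall i, (b i < a i)%N].

Lemma mnm_divE k : (mnm_scale (mnm_quo k) + mnm_rem k)%MM = k.
Proof. by apply/mnmP => i; rewrite !mnmE mulnC -divn_eq. Qed.

Lemma mnm_rem_reduced k : reduced (mnm_rem k).
Proof. by apply/forallP => i; rewrite mnmE ltn_mod. Qed.

Lemma mnm_quoD k b : reduced b -> mnm_quo (mnm_scale k + b) = k.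
Proof.
move=> /forallP red_b; apply/mnmP => i; rewrite !mnmE.
by rewrite mulnC divnMDl // divn_small ?addn0.
Qed.

Lemma mnm_remD k b : reduced b -> mnm_rem (mnm_scale k + b) = b.
Proof.
move=> /forallP red_b; apply/mnmP => i; rewrite !mnmE.
by rewrite mulnC modnMDl modn_small.
Qed.

Lemma leq_mdeg_scale k b : (mdeg k <= mdeg (mnm_scale k + b)%MM)%N.
Proof.
rewrite !mdegE; apply: leq_sum => i _; rewrite !mnmE.
by apply: leq_trans (leq_addr _ _); rewrite leq_pmull.
Qed.

Lemma sigmaX k : sigma 'X_[k] = 'X_[mnm_scale k].
Proof.
rewrite [LHS]comp_mpolyX mpolyXE_id; apply: eq_bigr => i _.
by rewrite tnth_mktuple mnmE exprM.
Qed.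

Lemma sigmaM f g : sigma (f * g) = sigma f * sigma g.
Proof. exact: rmorphM. Qed.

Lemma sigmaD f g : sigma (f + g) = sigma f + sigma g.
Proof. exact: comp_mpolyD. Qed.

Lemma sigmaZ (c : K) f : sigma (c *: f) = c *: sigma f.
Proof. exact: comp_mpolyZ. Qed.

Lemma sigma0 : sigma 0 = 0.
Proof. exact: comp_mpoly0. Qed.

(** The coordinate of u along x^b in the basis of reduced monomials of S over
    sigma(S), when b is reduced; the bound on k only makes the sum finite. *)
Definition retract b u : S :=
  \sum_(k : 'X_{1..n < msize u}) u@_(mnm_scale k + b) *: 'X_[k].

Lemma mcoeff_retract b u k : (retract b u)@_k = u@_(mnm_scale k + b).
Proof.
have [lt_k|le_k] := ltnP (mdeg k) (msize u).
  exact: (mcoeff_mpoly (fun k => u@_(mnm_scale k + b))).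
rewrite memN_msupp_eq0 ?memN_msupp_eq0 //.
  by apply: msize_mdeg_ge; apply: leq_trans (leq_mdeg_scale k b).
apply/negP => /msupp_sum_le /flattenP[_ /mapP[l _ ->]].
move=> /msuppZ_le; rewrite msuppX inE => /eqP def_k.
by have := bmdeg l; rewrite -def_k ltnNge le_k.
Qed.

Lemma retractD b : {morph retract b : u v / u + v}.
Proof. by move=> u v; apply/mpolyP => k; rewrite !(mcoeff_retract, mcoeffD). Qed.

Lemma retractZ b c u : retract b (c *: u) = c *: retract b u.
Proof. by apply/mpolyP => k; rewrite !(mcoeff_retract, mcoeffZ). Qed.

Lemma retract0 b : retract b 0 = 0.
Proof. by apply/mpolyP => k; rewrite !(mcoeff_retract, mcoeff0). Qed.

Lemma retractX b k :
  reduced b -> retract b 'X_[k] = if mnm_rem k == b then 'X_[mnm_quo k] else 0.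
Proof.
move=> red_b; apply/mpolyP => l; rewrite mcoeff_retract mcoeffX.
case: eqP => [->|neq_k].
  by rewrite mnm_remD // eqxx mcoeffX mnm_quoD // eqxx.
case: eqP => rem_k; last by rewrite mcoeff0.
rewrite mcoeffX; case: eqP => // quo_k; case: neq_k.
by rewrite -quo_k -rem_k mnm_divE.
Qed.

(** Linearity over sigma(S); both sides are bilinear in f and u, so monomials
    suffice. *)
Lemma retractM b f u : reduced b -> retract b (sigma f * u) = f * retract b u.
Proof.
move=> red_b; elim/mpolyind: f => [|c k f _ _ IHf].
  by rewrite sigma0 !mul0r retract0.
rewrite sigmaD !mulrDl retractD IHf sigmaZ -!scalerAl retractZ sigmaX.
congr (_ *: _ + _); elim/mpolyind: u {IHf} => [|d l u _ _ IHu].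
  by rewrite mulr0 retract0 mulr0.
rewrite mulrDr !retractD mulrDr IHu -!scalerAr !retractZ -scalerAr.
congr (_ *: _ + _); rewrite -mpolyXD !retractX //.
have -> : mnm_rem (mnm_scale k + l) = mnm_rem l.
  by apply/mnmP => i; rewrite !mnmE mulnC modnMDl.
have -> : mnm_quo (mnm_scale k + l) = (k + mnm_quo l)%MM.
  by apply/mnmP => i; rewrite !mnmE mulnC divnMDl.
by case: eqP => _; rewrite ?mulr0 // mpolyXD.
Qed.

Lemma reduced_mdeg b : reduced b -> (mdeg b < (\sum_i a i).+1)%N.
Proof.
move=> /forallP red_b; rewrite ltnS mdegE; apply: leq_sum => i _.
exact: ltnW.
Qed.

(** Reduced monomials span S over sigma(S), by division of exponents by a. *)
Lemma retract_decomposition u :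
  u = \sum_(b : 'X_{1..n < (\sum_i a i).+1} | reduced b) 'X_[b] * sigma (retract b u).
Proof.
have := reduced_mdeg; set N := (\sum_i a i).+1 => mdeg_lt.
elim/mpolyind: u => [|c k u _ _ IHu].
  by rewrite big1 // => b _; rewrite retract0 sigma0 mulr0.
under eq_bigr => b _ do rewrite retractD sigmaD mulrDr retractZ sigmaZ -scalerAr.
rewrite big_split /= -IHu -scaler_sumr; congr (_ *: _ + _).
pose r := BMultinom (mdeg_lt _ (mnm_rem_reduced k)).
rewrite (bigD1 r) ?mnm_rem_reduced //= big1 => [|b /andP[red_b neq_b]].
  rewrite retractX ?mnm_rem_reduced // eqxx sigmaX -mpolyXD addr0.
  by rewrite [(mnm_rem k + _)%MM]addmC mnm_divE.
rewrite retractX // ifN ?sigma0 ?mulr0 //.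
by apply: contra neq_b => /eqP eq_b; rewrite bmeqP /= eq_b.
Qed.

Lemma trivial_modification_ideal B : is_ideal (T B).
Proof. exact: ideal_gen_ideal. Qed.

Lemma sigma_mem B f : B f -> T B (sigma f).
Proof. by move=> Bf; apply: sub_gen_smallest; exists f. Qed.

(** The set of all u such that every multiple of u has coordinates in B is an
    ideal containing sigma(B), hence the modification. The converse is the
    decomposition along reduced monomials. *)
Lemma trivial_modificationP B u : is_ideal B ->
  T B u <-> forall b, reduced b -> B (retract b u).
Proof.
move=> idB; split=> [TBu b red_b|Bu].
  have idC : is_ideal [set u | forall f, B (retract b (f * u))].
    split=> [f|v w Bv Bw f|f v Bv g]; rewrite ?mulr0 ?retract0 //.
    - exact: ideal0.
    - by rewrite mulrDr retractD; apply: idealD.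
    - by rewrite mulrA.
  have := ideal_gen_sub idC _ TBu 1; rewrite mul1r; apply.
  by move=> _ [v Bv <-] f; rewrite /= mulrC retractM // mulrC; apply: idealM.
rewrite [u]retract_decomposition; apply: ideal_sum => [|b red_b].
  exact: trivial_modification_ideal.
apply: (@idealM _ _ (T B)); first exact: trivial_modification_ideal.
by apply: sigma_mem; apply: Bu.
Qed.

Lemma reduced0 : reduced 0%MM.
Proof. by apply/forallP => i; rewrite mnmE. Qed.

Lemma retract_sigma f : retract 0%MM (sigma f) = f.
Proof.
rewrite -[sigma f]mulr1 retractM ?reduced0 // -mpolyX0 retractX ?reduced0 //.
have -> : mnm_rem 0 = 0%MM by apply/mnmP => i; rewrite !mnmE mod0n.
have -> : mnm_quo 0 = 0%MM by apply/mnmP => i; rewrite !mnmE div0n.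
by rewrite eqxx mpolyX0 mulr1.
Qed.

Lemma sigma_memP B f : is_ideal B -> T B (sigma f) <-> B f.
Proof.
move=> idB; split; last exact: sigma_mem.
by move=> /(trivial_modificationP _ idB)/(_ _ reduced0); rewrite retract_sigma.
Qed.

Lemma trivial_modification0 : T [set 0] = [set 0].
Proof.
apply/seteqP; split=> [|_ ->]; last exact: (ideal0 (trivial_modification_ideal _)).
apply: ideal_gen_sub; first exact: is_ideal0.
by move=> _ [_ -> <-]; rewrite /= sigma0.
Qed.

Lemma trivial_modification_neq0 I : is_ideal I -> I <> [set 0] -> T I <> [set 0].
Proof.
move=> idI I0 TI0; apply: I0; apply/seteqP; split=> [f If|_ ->]; last exact: ideal0.
have /(sigma_memP _ (is_ideal0 n K)) // : T [set 0] (sigma f).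
by rewrite trivial_modification0 -TI0; apply: sigma_mem.
Qed.

Lemma trivial_modification_add_mul A B f :
  is_ideal A -> is_ideal B ->
  T (add_mul A B f) = add_mul (T A) (T B) (sigma f).
Proof.
move=> idA idB; have idTA := trivial_modification_ideal A.
have idTB := trivial_modification_ideal B.
apply/seteqP; split.
  apply: ideal_gen_sub; first exact: add_mul_ideal.
  move=> _ [_ [b Bb [c Ac <-]] <-].
  exists (sigma b); first exact: sigma_mem.
  by exists (sigma c); [exact: sigma_mem|rewrite sigmaD sigmaM].
move=> _ [b TBb [c TAc <-]]; apply: (@idealD _ _ (T (add_mul A B f))).
- exact: trivial_modification_ideal.
- by apply/trivial_modificationP => [|d red_d]; [exact: add_mul_ideal|
  apply: sub_add_mul => //; apply: (trivial_modificationP _ _).1].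
- apply/trivial_modificationP => [|d red_d]; first exact: add_mul_ideal.
  rewrite retractM //; exists 0; first exact: ideal0.
  by exists (retract d c); rewrite ?add0r //; apply: (trivial_modificationP _ _).1.
Qed.

Lemma trivial_modification_add_muls A B s :
  is_ideal A -> is_ideal B ->
  T (add_muls A B s) = add_muls (T A) (T B) (map sigma s).
Proof.
move=> idA; elim: s B => [//|f s IH] B idB /=.
by rewrite IH ?trivial_modification_add_mul //; apply: add_mul_ideal.
Qed.

(** Flatness of sigma: taking coordinates turns multiplication by sigma f into
    multiplication by f. *)
Lemma nonzerodivisor_sigma A B f :
  is_ideal A -> is_ideal B ->
  nonzerodivisor A B f -> nonzerodivisor (T A) (T B) (sigma f).
Proof.
move=> idA idB nzf u /(trivial_modificationP _ idA) Au.
move=> /(trivial_modificationP _ idB) Bfu.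
apply/trivial_modificationP => // b red_b; apply: nzf; first exact: Au.
by rewrite -retractM //; apply: Bfu.
Qed.

Lemma regular_sigma A B s :
  is_ideal A -> is_ideal B -> regular A B s -> regular (T A) (T B) (map sigma s).
Proof.
move=> idA; elim: s B => [//|f s IH] B idB /= [nzf reg_s].
split; first exact: nonzerodivisor_sigma.
rewrite -trivial_modification_add_mul //; apply: IH => //.
exact: add_mul_ideal.
Qed.

Lemma sigma_max_ideal f : m f -> m (sigma f).
Proof.
have idm := @max_ideal_ideal n K.
suff : m `<=` [set f | m (sigma f)] by apply.
apply: ideal_gen_sub => [|_ [i _ <-]].
  split=> [|g h|g h] /=; first by rewrite sigma0; apply: (@ideal0 _ _ m).
    by rewrite sigmaD; apply: (@idealD _ _ m).
  by rewrite sigmaM; apply: (@idealM _ _ m).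
rewrite /= sigmaX.
have -> : mnm_scale U_(i) = ((mnm_scale U_(i) - U_(i)) + U_(i))%MM.
  rewrite submK //; apply/mnm_lepP => j; rewrite !mnmE.
  by case: (i == j); rewrite ?muln1.
by rewrite mpolyXD; apply: (@idealM _ _ m) => //; apply: max_ideal_mem.
Qed.

(** Otherwise a monomial multiple x^k w outside B of largest degree is a socle
    element of A/B; the degrees are bounded because x_i^(a_i) w is in B. *)
Lemma no_socle_power A B w :
  is_ideal A -> is_ideal B -> no_socle m A B ->
  A w -> (forall i, B ('X_i ^+ a i * w)) -> B w.
Proof.
move=> idA idB socB Aw Bw; apply: contrapT => nBw.
pose P d := `[< exists2 k, mdeg k = d & ~ B ('X_[k] * w) >].
have exP : exists d, P d.
  by exists 0%N; apply/asboolP; exists 0%MM; rewrite ?mdeg0 ?mpolyX0 ?mul1r.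
have ubP d : P d -> (d <= \sum_i a i)%N.
  move=> /asboolP[k <- nBk]; rewrite mdegE; apply: leq_sum => i _.
  rewrite leqNgt; apply/negP => lt_ak; apply: nBk.
  have -> : k = ((k - U_(i) *+ a i) + U_(i) *+ a i)%MM.
    rewrite submK //; apply/mnm_lepP => j; rewrite mulmnE mnm1E.
    by case: eqP => [<-|_]; rewrite ?mul1n ?mul0n // ltnW.
  by rewrite mpolyXD -mpolyXn -mulrA; apply: idealM.
case: (ex_maxnP exP ubP) => d /asboolP[k deg_k nBk] max_d.
apply: nBk; apply: socB; first exact: idealM.
suff le_m : m `<=` annihilator B ('X_[k] * w) by move=> f /le_m.
apply: ideal_gen_sub; first exact: annihilator_ideal.
move=> _ [i _ <-]; apply: contrapT => nBki.
have := max_d d.+1; rewrite ltnn => /(_ _)/negP; apply; last by [].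
apply/asboolP; exists (U_(i) + k)%MM; first by rewrite mdegD mdeg1 deg_k.
by rewrite mpolyXD -mulrA.
Qed.

(** If u is a socle element of A/B, then sigma u is killed by all x_i^(a_i) =
    sigma x_i. *)
Lemma no_socle_sigma A B :
  is_ideal A -> is_ideal B -> no_socle m (T A) (T B) -> no_socle m A B.
Proof.
move=> idA idB socT u Au mu; apply/(sigma_memP _ idB).
apply: (no_socle_power (trivial_modification_ideal A)) => //.
- exact: trivial_modification_ideal.
- exact: sigma_mem.
move=> i; have -> : 'X_i ^+ a i = sigma 'X_i :> S.
  rewrite sigmaX mpolyXn; congr 'X_[_]; apply/mnmP => j.
  by rewrite mulmnE !mnmE mulnC; case: eqP => [->|_]; rewrite ?muln0.
by rewrite -sigmaM; apply: sigma_mem; apply: mu; apply: max_ideal_mem.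
Qed.

(** Regular sequences on I map to regular sequences on its modification T I. In
    the other direction, Rees' theorem on T I shows that a sequence on I which
    is shorter than one on T I can be lengthened. *)
Lemma depth_lengths_trivial_modification I :
  is_ideal I -> depth_lengths (T I) = depth_lengths I.
Proof.
move=> idI; have id0 := is_ideal0 n K; have idm := @max_ideal_ideal n K.
have idTI := trivial_modification_ideal I.
have reg_T s : regular I [set 0] s -> regular (T I) [set 0] (map sigma s).
  by move=> /(regular_sigma idI id0); rewrite trivial_modification0.
have sub_T s : [set` s] `<=` m -> [set` map sigma s] `<=` m.
  by move=> sm _ /mapP[f fs ->]; apply: sigma_max_ideal; apply: sm.
apply/seteqP; split=> k [s [size_s sm reg_s]]; last first.
  by exists (map sigma s); split; [rewrite size_map|exact: sub_T|exact: reg_T].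
suff [t [size_t tm reg_t]] : depth_lengths I k by exists t.
have: (k <= size s)%N by rewrite size_s.
elim: k {size_s} => [_|k IHk lt_ks]; first by exists [::].
have [t [size_t tm reg_t]] := IHk (ltnW lt_ks).
have socT := regular_shorter_no_socle idm idTI id0 sm (sub_T t tm) reg_s (reg_T t reg_t).
have idt : is_ideal (add_muls I [set 0] t) by exact: add_muls_ideal.
have [|h mh nzh] := no_socle_nonzerodivisor idm idI idt.
  apply: no_socle_sigma => //.
  rewrite trivial_modification_add_muls // trivial_modification0.
  by apply: socT; rewrite size_map size_t.
exists (rcons t h); split; first by rewrite size_rcons size_t.
  by move=> f /=; rewrite mem_rcons inE => /predU1P[->|/tm].
by apply/regular_rcons.
Qed.

Lemma depth_trivial_modification I :
  is_ideal I -> I <> [set 0] -> depth (T I) = depth I.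
Proof.
move=> idI I0; rewrite !depthE ?depth_lengths_trivial_modification //.
- exact: trivial_modification_ideal.
- exact: trivial_modification_neq0.
Qed.

End TrivialModification.

(** * Stanley depth of a trivial modification *)

Lemma supremum_nat_le (A : set nat) N :
  (forall k, A k -> (k <= N)%N) -> (supremum 0%N A <= N)%N.
Proof.
move=> ubN; rewrite /supremum; case: ifPn => // _.
case: xgetP => [d _ [_ min_d]|_]; last by [].
by rewrite -leEnat; apply: min_d => k /ubN; rewrite leEnat.
Qed.

Lemma leq_supremum_nat (A : set nat) N k :
  (forall l, A l -> (l <= N)%N) -> A k -> (k <= supremum 0%N A)%N.
Proof.
move=> ubN Ak; rewrite -leEnat; apply: ge_supremum_Nmem => //.
by apply: nat_supremums_neq0; exists N => l /ubN.
Qed.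

Section StanleyDepth.
Variables (n : nat) (K : fieldType).
Local Notation S := {mpoly K[n]}.
Implicit Types (I J : set S) (u v w : S) (k l b : 'X_{1..n}) (Z : {set 'I_n}).

(** The exponents l of the monomials in x^k K[Z]. *)
Definition cone Z k l := [forall i, if i \in Z then (k i <= l i)%N else l i == k i].

Lemma coneP Z k l :
  reflect ((k <= l)%MM /\ forall i, i \notin Z -> l i = k i) (cone Z k l).
Proof.
apply: (iffP forallP) => [kl|[/mnm_lepP le_kl eq_kl] i].
  split=> [|i nZi]; last by have := kl i; rewrite (negPf nZi) => /eqP.
  by apply/mnm_lepP => i; have := kl i; case: ifP => // _ /eqP ->.
by case: ifP => [_|/negbT/eq_kl ->].
Qed.

Lemma cone_apex Z k : cone Z k k.
Proof. by apply/coneP; split; first exact: lepm_refl. Qed.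

Lemma span_inP (c : K) k Z v : c != 0 ->
  span_in (c *: 'X_[k]) Z v <-> forall l, l \in msupp v -> cone Z k l.
Proof.
move=> c0; split=> [[f Zf <-] l|Zv].
  rewrite -scalerAl => /msuppZ_le; rewrite mulrC (perm_mem (msuppMX _ _)).
  move=> /mapP[d fd ->]; apply/coneP; split; first exact: lem_addr.
  by move=> i /(Zf d fd i) d0; rewrite mnmDE d0 addn0.
pose f : S := \sum_(l <- msupp v) (c^-1 * v@_l) *: 'X_[l - k].
exists f => [d|].
  move=> /msupp_sum_le /flattenP[t /mapP[l]]; rewrite filter_predT => vl ->.
  move=> /msuppZ_le; rewrite msuppX inE => /eqP -> i nZi.
  have /coneP[_ /(_ i nZi) eq_l] := Zv l vl.
  by rewrite mnmBE eq_l subnn.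
rewrite [RHS]mpolyE /f mulr_sumr; apply: eq_big_seq => l vl.
have /coneP[le_kl _] := Zv l vl.
rewrite -scalerAl -scalerAr scalerA mulrA mulfV // mul1r -mpolyXD.
by rewrite addmC submK.
Qed.

Definition cone_partition J r (k : 'I_r -> 'X_{1..n}) (Z : 'I_r -> {set 'I_n}) :=
  (forall u, J u <-> forall l, l \in msupp u -> exists i, cone (Z i) (k i) l)
  /\ forall i j l, cone (Z i) (k i) l -> cone (Z j) (k j) l -> i = j.

(** The generators are c x^k with c nonzero, so the spaces z_i K[Z_i] are spanned
    by monomials and the direct sum can be read off on monomials. *)
Lemma cone_partition_of_stanley I r (z : 'I_r -> S) (Z : 'I_r -> {set 'I_n}) :
  is_ideal I -> stanley_decomposition I z Z ->
  exists k : 'I_r -> 'X_{1..n}, cone_partition I k Z.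
Proof.
move=> idI [spZ sumZ freeZ].
have zP i : exists ck : K * 'X_{1..n}, ck.1 != 0 /\ z i = ck.1 *: 'X_[ck.2].
  have [_ [c [k def_z]] free_z] := spZ i; exists (c, k); split=> //=.
  apply/eqP => c0; suff /eqP : 1 = 0 :> S by rewrite oner_eq0.
  apply: free_z.
    by move=> l; rewrite -mpolyC1 msupp1 inE => /eqP -> j _; rewrite mnmE.
  by rewrite def_z c0 scale0r mul0r.
have [ck ckP] := choice zP; exists (fun i => (ck i).2).
have spanP i v : span_in (z i) (Z i) v <->
    forall l, l \in msupp v -> cone (Z i) (ck i).2 l.
  by have [c0 ->] := ckP i; apply: span_inP.
have span0 i : span_in (z i) (Z i) 0 by apply/spanP => l; rewrite msupp0.
have spanX i l : cone (Z i) (ck i).2 l -> span_in (z i) (Z i) 'X_[l].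
  by move=> Zl; apply/spanP => d; rewrite msuppX inE => /eqP ->.
split=> [u|i j l Zil Zjl].
  split=> [/sumZ[v spv ->] l /msupp_sum_le /flattenP[_ /mapP[i _ ->] vl]|Zu].
    by exists i; apply: (spanP i (v i)).1.
  rewrite [u]mpolyE big_seq; apply: ideal_sum => // l /Zu[i Zil].
  rewrite -mul_mpolyC; apply: idealM => //; apply/sumZ.
  exists (fun j => if j == i then 'X_[l] else 0) => [j|].
    by case: eqP => [->|_]; [apply: spanX|].
  by rewrite -big_mkcond big_pred1_eq.
apply/eqP; apply: contraT => neq_ij.
(* The relation x^l - x^l = 0 between the i-th and j-th spaces. *)
pose v h : S := if h == i then 'X_[l] else if h == j then - 'X_[l] else 0.
have := freeZ v _ _ i; rewrite /v eqxx => /(_ _ _)/eqP.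
rewrite -msupp_eq0 msuppX; apply=> [h|].
  case: eqP => [->|_]; first exact: spanX.
  case: eqP => [->|_] //; apply/spanP => d.
  by rewrite (perm_mem (msuppN _)) msuppX inE => /eqP ->.
have neq_ji : (j == i) = false by rewrite eq_sym (negPf neq_ij).
rewrite (bigD1 i) //= eqxx (bigD1 j) ?neq_ji //= eqxx.
rewrite big1 ?addr0 ?subrr // => h /andP[/negPf -> /negPf ->] //.
Qed.

Lemma stanley_of_cone_partition J r (k : 'I_r -> 'X_{1..n})
    (Z : 'I_r -> {set 'I_n}) :
  cone_partition J k Z ->
  stanley_decomposition J (fun i => 'X_[k i]) Z.
Proof.
move=> [coverZ disjZ].
have spanP i v : span_in 'X_[k i] (Z i) v <->
    forall l, l \in msupp v -> cone (Z i) (k i) l.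
  by rewrite -[X in span_in X]scale1r; apply: span_inP; apply: oner_neq0.
split=> [i|u|v spv sum0 i].
- split; last 1 first.
  + move=> f _ /eqP; rewrite mulf_eq0 -msupp_eq0 msuppX /=.
    by move=> /eqP.
  + apply/coverZ => l; rewrite msuppX inE => /eqP ->.
    by exists i; apply: cone_apex.
  + by exists 1, (k i); rewrite scale1r.
- split=> [/coverZ Zu|[v spv ->]].
    exists (fun i => \sum_(l <- msupp u | cone (Z i) (k i) l) u@_l *: 'X_[l]).
      move=> i; apply/spanP => l /msupp_sum_le /flattenP[t /mapP[d]].
      rewrite mem_filter => /andP[Zid _] -> /msuppZ_le.
      by rewrite msuppX inE => /eqP ->.
    rewrite {1}[u]mpolyE (exchange_big_dep xpredT) //=.
    apply: eq_big_seq => l ul; have [i Zil] := Zu l ul.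
    rewrite (big_pred1 i) // => j; apply/idP/eqP => [Zjl|-> //].
    exact: disjZ Zjl Zil.
  apply/coverZ => l /msupp_sum_le /flattenP[_ /mapP[i _ ->] vl].
  by exists i; apply: (spanP i (v i)).1.
- apply/mpolyP => l; rewrite mcoeff0; apply/eqP; apply: contraT.
  rewrite -mcoeff_msupp => vil; have Zil := (spanP i (v i)).1 (spv i) l vil.
  have : (\sum_(j < r) v j)@_l = 0 by rewrite sum0 mcoeff0.
  rewrite raddf_sum (bigD1 i) //= big1 ?addr0 => [vil0|j neq_ji].
    by move: vil; rewrite mcoeff_msupp vil0 eqxx.
  apply: memN_msupp_eq0; apply: contra neq_ji => vjl; apply/eqP.
  exact: disjZ ((spanP j (v j)).1 (spv j) l vjl) Zil.
Qed.

Lemma leq_sdepth_decomposition d r (Z : 'I_r -> {set 'I_n}) :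
  (d <= sdepth_decomposition Z)%N <-> (d <= n)%N /\ forall i, (d <= #|Z i|)%N.
Proof.
rewrite /sdepth_decomposition; split=> [|[le_dn le_dZ]]; last first.
  by elim/big_ind: _ => // x y le_dx le_dy; rewrite leq_min le_dx.
suff : (d <= \big[minn/n]_(i < r) #|Z i|)%N ->
    (d <= n)%N /\ forall i, i \in index_enum 'I_r -> (d <= #|Z i|)%N.
  by move=> H /H[? H']; split=> // i; apply: H'; apply: mem_index_enum.
elim: (index_enum _) => [|i s IH]; first by rewrite big_nil.
rewrite big_cons leq_min => /andP[le_di /IH[le_dn le_dZ]]; split=> // j.
by rewrite inE => /predU1P[->|/le_dZ].
Qed.

Variable a : 'I_n -> nat.
Hypothesis a_neq0 : forall i, a i <> 0%N.

Let a_gt0 i : (0 < a i)%N. Proof. by rewrite lt0n; apply/eqP. Qed.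

(** In the directions of Z the condition is a k_i <= l_i, equivalent to
    k_i <= l_i / a_i; in the others l_i is prescribed, so its quotient and its
    remainder are. *)
Lemma cone_quo Z k b l : reduced a b -> (forall i, i \in Z -> b i = 0%N) ->
  cone Z (mnm_scale a k + b) l =
  cone Z k (mnm_quo a l) && [forall i, (i \in Z) || (b i == l i %% a i)%N].
Proof.
move=> /forallP red_b b0.
apply/forallP/andP => [H|[/forallP H /forallP H'] i].
  split; apply/forallP => i; have := H i; case: (boolP (i \in Z)) => //= Zi.
  - by rewrite !mnmE b0 // addn0 leq_divRL // mulnC.
  - by rewrite !mnmE => /eqP ->; rewrite mulnC divnMDl // divn_small ?addn0.
  - by rewrite !mnmE => /eqP ->; rewrite mulnC modnMDl modn_small.
have := H i; have := H' i; case: ifP => [Zi _|_ /= /eqP def_b].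
  by rewrite !mnmE b0 // addn0 leq_divRL // mulnC.
rewrite !mnmE => /eqP <-; rewrite def_b.
by rewrite {1}(divn_eq (l i) (a i)) mulnC.
Qed.

(** The cones of the modification are indexed by pairs (i, b) with b reduced and
    zero on Z_i; p forgets b. *)
Lemma cone_partition_trivial_modification I r (k : 'I_r -> 'X_{1..n})
    (Z : 'I_r -> {set 'I_n}) :
  is_ideal I -> cone_partition I k Z ->
  exists r' (k' : 'I_r' -> 'X_{1..n}) (p : 'I_r' -> 'I_r),
    cone_partition (trivial_modification a I) k' (fun i => Z (p i)).
Proof.
move=> idI [coverZ disjZ].
pose N := (\sum_i a i).+1.
pose P : {pred 'I_r * 'X_{1..n < N}} :=
  [pred q : 'I_r * 'X_{1..n < N} | reduced a q.2 & [forall i in Z q.1, q.2 i == 0%N :> nat]].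
have PP q : q \in P -> reduced a q.2 /\ forall i, i \in Z q.1 -> q.2 i = 0%N :> nat.
  by case/andP => red_q /forall_inP q0; split=> // i /q0/eqP.
pose e (h : 'I_#|P|) : 'I_r * 'X_{1..n < N} := enum_val h.
have eP h : e h \in P by apply: enum_valP.
exists #|P|, (fun h => mnm_scale a (k (e h).1) + (e h).2)%MM, (fun h => (e h).1).
have T_quo u : trivial_modification a I u <-> forall l, l \in msupp u ->
    exists i, cone (Z i) (k i) (mnm_quo a l).
  rewrite trivial_modificationP //; split=> [Iu l ul|Zu b red_b].
    apply: (coverZ _).1 (Iu _ (mnm_rem_reduced a_neq0 l)) _ _.
    by rewrite mcoeff_msupp mcoeff_retract // mnm_divE // -mcoeff_msupp.
  apply/coverZ => l; rewrite mcoeff_msupp mcoeff_retract // -mcoeff_msupp.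
  by move=> /Zu; rewrite mnm_quoD.
split=> [u|h1 h2 l].
  rewrite T_quo; split=> Zu l /Zu => [[i Zil]|[h]]; last first.
    have [red_h h0] := PP _ (eP h).
    by rewrite cone_quo // => /andP[Zhl _]; exists (e h).1.
  pose b : 'X_{1..n} := [multinom if j \in Z i then 0%N else (l j %% a j)%N | j < n].
  have red_b : reduced a b.
    by apply/forallP => j; rewrite mnmE; case: ifP => // _; rewrite ltn_mod.
  pose q : 'I_r * 'X_{1..n < N} := (i, BMultinom (reduced_mdeg red_b)).
  have Pq : q \in P.
    by apply/andP; split=> //; apply/forall_inP => j /= Zj; rewrite mnmE Zj.
  exists (enum_rank_in Pq q); rewrite /e enum_rankK_in //.
  have [red_q q0] := PP q Pq.
  rewrite cone_quo // Zil; apply/forallP => j /=; rewrite mnmE.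
  by case: (j \in Z i) => /=.
have [red_h1 h10] := PP _ (eP h1); have [red_h2 h20] := PP _ (eP h2).
rewrite !cone_quo // => /andP[Z1 /forallP rem1] /andP[Z2 /forallP rem2].
apply: enum_val_inj; rewrite -/(e h1) -/(e h2); have eq_i := disjZ _ _ _ Z1 Z2.
rewrite [LHS]surjective_pairing [RHS]surjective_pairing eq_i; congr (_, _).
apply/eqP; rewrite bmeqP; apply/eqP/mnmP => j.
have := rem1 j; have := rem2 j; case: (boolP (j \in Z (e h2).1)) => Zj.
  by rewrite h10 ?eq_i // h20.
by rewrite eq_i (negPf Zj) => /eqP -> /eqP ->.
Qed.

Lemma sdepth_trivial_modification I :
  is_ideal I -> (sdepth I <= sdepth (trivial_modification a I))%N.
Proof.
move=> idI; apply: supremum_nat_le => d [r [z [Z [decI <-]]]].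
have [k partI] := cone_partition_of_stanley idI decI.
have [r' [k' [p partT]]] := cone_partition_trivial_modification idI partI.
have [le_dn le_dZ] := (leq_sdepth_decomposition _ Z).1 (leqnn _).
apply: (@leq_trans (sdepth_decomposition (fun i => Z (p i)))).
  by apply/leq_sdepth_decomposition.
apply: (@leq_supremum_nat _ n) => [_ [r0 [z0 [Z0 [_ <-]]]]|].
  by case: ((leq_sdepth_decomposition _ Z0).1 (leqnn _)).
by exists r', (fun i => 'X_[k' i]), (fun i => Z (p i)); split=> //;
  apply: stanley_of_cone_partition.
Qed.

End StanleyDepth.

Theorem corollary2p7 (n : nat) (K : fieldType) (I : set {mpoly K[n]})
    (a : 'I_n -> nat)
    (hI : squarefree_monomial_ideal I) (hI0 : I <> [set 0])
    (ha : forall i, a i <> 0%N) :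
  (depth I <= sdepth I)%N ->
  (depth (trivial_modification a I) <= sdepth (trivial_modification a I))%N.
Proof.
have idI : is_ideal I by case: hI => E [_ ->]; apply: ideal_gen_ideal.
rewrite depth_trivial_modification // => le_depth.
exact: leq_trans le_depth (sdepth_trivial_modification ha idI).
Qed.
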